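(* Let $\kappa$ be an arbitrary field and let $P(X,Y)\in\kappa[X,Y]$ be a polynomial such that $P(0,0)=0$ and $P'_Y(0,0)=0$. Let $f(X)=\sum_{n\geq 1} f_n X^n\in\kappa[[X]]$ be the algebraic formal power series (with zero constant term) defined implicitly by $f(X)=P(X,f(X))$. Then for every $n\geq 1$ the coefficient $f_n$ is given by the infinite sum $$f_n=\sum_{m\geq 1}[X^nY^{m-1}]\,\bigl(1-P'_Y(X,Y)\bigr)\,P(X,Y)^m .$$
   Context: $P'_Y=\partial P/\partial Y$ denotes the formal partial derivative of $P$ with respect to $Y$. For a polynomial or formal power series $A=\sum_{i,j}a_{i,j}X^iY^j$ in two variables over $\kappa$, $[X^iY^j]A$ denotes the coefficient $a_{i,j}\in\kappa$. In the formula, the coefficient is extracted from the whole product $(1-P'_Y(X,Y))P(X,Y)^m$. The infinite sum over $m$ of elements of $\kappa$ is to be understood as a sum with only finitely many nonzero terms for each fixed $n$ (no topology on $\kappa$ is involved). *)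

(* Defs.v *)
From HB Require Import structures.
From mathcomp Require Import all_boot all_order all_algebra.
From mathcomp Require Import boolp classical_sets cardinality fsbigop.

Set Implicit Arguments.
Unset Strict Implicit.
Unset Printing Implicit Defensive.

Import GRing.Theory.
Local Open Scope ring_scope.

(* [f i] is the coefficient of X^i.  This is a record rather than an alias of
   [nat -> R] so that the Cauchy product below cannot be confused with the
   pointwise product of functions. *)
Record powser (R : Type) := PowSer { coefps :> nat -> R }.

HB.instance Definition _ (R : Type) := [isNew for @coefps R].
HB.instance Definition _ (R : Type) := gen_eqMixin (powser R).
HB.instance Definition _ (R : Type) := gen_choiceMixin (powser R).

Lemma powserP (R : Type) (f g : powser R) : f =1 g -> f = g.
Proof. by case: f g => [f] [g] /= /funext ->. Qed.

Section PowerSeriesRing.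
Variable R : comNzRingType.
Implicit Types (f g h : powser R) (p q : {poly R}).

Definition ps_zero : powser R := PowSer (fun=> 0).
Definition ps_opp f : powser R := PowSer (fun n => - f n).
Definition ps_add f g : powser R := PowSer (fun n => f n + g n).
Definition ps_one : powser R := PowSer (fun n => (n == 0)%:R).
Definition ps_mul f g : powser R :=
  PowSer (fun n => \sum_(i < n.+1) f i * g (n - i)%N).

Fact ps_addA : associative ps_add.
Proof. by move=> f g h; apply: powserP => n /=; rewrite addrA. Qed.
Fact ps_addC : commutative ps_add.
Proof. by move=> f g; apply: powserP => n /=; rewrite addrC. Qed.
Fact ps_add0 : left_id ps_zero ps_add.
Proof. by move=> f; apply: powserP => n /=; rewrite add0r. Qed.
Fact ps_addN : left_inverse ps_zero ps_opp ps_add.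
Proof. by move=> f; apply: powserP => n /=; rewrite addNr. Qed.

HB.instance Definition _ :=
  GRing.isZmodule.Build (powser R) ps_addA ps_addC ps_add0 ps_addN.

Definition ps_trunc (n : nat) f : {poly R} := \poly_(i < n.+1) f i.

Fact coef_ps_trunc n f i : (i <= n)%N -> (ps_trunc n f)`_i = f i.
Proof. by move=> le_in; rewrite coef_poly ltnS le_in. Qed.

Fact coef_ps_mul n f g i : (i <= n)%N ->
  ps_mul f g i = (ps_trunc n f * ps_trunc n g)`_i.
Proof.
move=> le_in; rewrite coefM; apply: eq_bigr => j _.
rewrite !coef_ps_trunc ?(leq_trans (leq_subr _ _)) //.
by rewrite (leq_trans _ le_in) // -ltnS.
Qed.

Fact ps_mulA : associative ps_mul.
Proof.
move=> f g h; apply: powserP => n.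
transitivity (ps_trunc n f * (ps_trunc n g * ps_trunc n h))`_n.
  rewrite coefM; apply: eq_bigr => j _.
  by rewrite (@coef_ps_mul n) ?leq_subr // coef_ps_trunc // -ltnS.
rewrite mulrA coefM; apply: eq_bigr => j _.
by rewrite (@coef_ps_mul n) -1?ltnS // coef_ps_trunc ?leq_subr.
Qed.

Fact ps_mulC : commutative ps_mul.
Proof.
by move=> f g; apply: powserP => n; rewrite !(@coef_ps_mul n) // mulrC.
Qed.

Fact ps_mul1 : left_id ps_one ps_mul.
Proof.
move=> f; apply: powserP => n /=.
by rewrite big_ord_recl subn0 mul1r big1 ?addr0 // => i _; rewrite mul0r.
Qed.

Fact ps_mulDl : left_distributive ps_mul ps_add.
Proof.
move=> f g h; apply: powserP => n /=.
by rewrite -big_split; apply: eq_bigr => i _; rewrite mulrDl.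
Qed.

Fact ps_one_neq0 : ps_one != ps_zero.
Proof.
by apply/eqP => /(congr1 (fun f : powser R => f 0)) /eqP; rewrite oner_eq0.
Qed.

HB.instance Definition _ := GRing.Zmodule_isComNzRing.Build (powser R)
  ps_mulA ps_mulC ps_mul1 ps_mulDl ps_one_neq0.

Definition powser_of_poly p : powser R := PowSer (fun n => p`_n).

Fact powser_of_poly_is_zmod_morphism : zmod_morphism powser_of_poly.
Proof. by move=> p q; apply: powserP => n /=; rewrite coefB. Qed.
HB.instance Definition _ := GRing.isZmodMorphism.Build {poly R} (powser R)
  powser_of_poly powser_of_poly_is_zmod_morphism.

Fact powser_of_poly_is_monoid_morphism : monoid_morphism powser_of_poly.
Proof.
split=> [|p q]; apply: powserP => n /=; first by rewrite coef1.
by rewrite coefM.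
Qed.
HB.instance Definition _ := GRing.isMonoidMorphism.Build {poly R} (powser R)
  powser_of_poly powser_of_poly_is_monoid_morphism.

(* Elements of R[X, Y] are represented in [{poly {poly R}}] as R[X][Y]: the
   outer variable is Y and the inner one is X (contrary to the naming of
   polyXY.v).  Hence [P^`()] is the partial derivative with respect to Y and
   [P.[0].[0]] is P(0, 0). *)

(* The coefficient of X^i Y^j. *)
Definition coefXY (i j : nat) (A : {poly {poly R}}) : R := A`_j`_i.

(* P(X, f(X)) *)
Definition subst_powser (P : {poly {poly R}}) f : powser R :=
  (map_poly powser_of_poly P).[f].

End PowerSeriesRing.

(* Main.v *)
Require Import Defs.
From HB Require Import structures.
From mathcomp Require Import all_boot all_order all_algebra.
From mathcomp Require Import boolp classical_sets cardinality fsbigop.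
From mathcomp Require Import zify ring.

(** Work in kappa[[X]][Y]. Since f is a root of Q := Y - P(X, Y), there is a
    factorization Q = (Y - f) U, so that Q' = U + (Y - f) U' (derivatives in
    Y), and U has constant term 1 because Q' does. Heuristically, the sum is
      sum_m [Y^-1] Q' (P / Y)^m = [Y^-1] Q' P / (Y - P) = [Y^-1] Y Q' / Q
        = [Y^-1] (Y / (Y - f) + Y U' / U) = [Y^-1] Y / (Y - f) = f,
    where P / (Y - P) may be replaced by Y / (Y - P) because they differ by 1,
    and Y U' / U contributes nothing because U is invertible as a power series.

    No Laurent series is needed to make this rigorous. Let X have weight 2 and
    Y weight 1. The two conditions on P at the origin say that all monomials of
    P have weight at least 2, hence those of P^m have weight at least 2m. The
    monomial X^n Y^(m-1) has weight 2n + m - 1, so only the terms with m < 2n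
    can contribute. Truncating at some M >= 2n, the geometric sums
      S = sum_(i < M) Y^(M-1-i) P^i  and  D = sum_(i < M) Y^(M-1-i) f^i
    satisfy Q S = Y^M - P^M and (Y - f) D = Y^M - f^M, and they play the roles
    of Y^M / Q and Y^M / (Y - f). The sum to compute is the coefficient of
    X^n Y^(M-1) in Q' P S, and f_n is the coefficient of the same monomial in
    Y D. These two polynomials agree modulo the ideal of the polynomials whose
    monomials are all divisible by Y^M or of weight at least 2M
    ([negligible M]):
    - Q S is in the ideal, hence so is (Y - f) S, because U is invertible
      modulo the ideal ([negligible_cancel_unit]);
    - (Y - f) (U S - D) = f^M - P^M has weight at least 2M, and Y - f has
      initial form Y, so that U S - D has weight at least 2M - 1
      ([weight_ge_cancel]);
    - therefore Q' P S = Q' (Y - Q) S = Y Q' S = Y U S = Y D modulo the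
      ideal. *)

Set Implicit Arguments.
Unset Strict Implicit.
Unset Printing Implicit Defensive.

Import GRing.Theory.
Local Open Scope classical_set_scope.
Local Open Scope ring_scope.

(** * The weight filtration *)

Section Weight.
Variable R : comNzRingType.
Implicit Types (f : powser R) (G H V : {poly powser R}).

Lemma coefps_sum (I : Type) (r : seq I) (A : pred I) (F : I -> powser R) i :
  (\sum_(k <- r | A k) F k) i = \sum_(k <- r | A k) F k i.
Proof. exact: (big_morph (fun g : powser R => g i) (fun _ _ => erefl) erefl). Qed.

Lemma coefps_coefM G H i j :
  (G * H)`_j i =
    \sum_(k < j.+1) \sum_(l < i.+1) G`_k l * H`_(j - k)%N (i - l)%N.
Proof. by rewrite coefM coefps_sum. Qed.

(** The weight of X has to be 2: with X and Y both of weight 1, a monomial X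
    of P would have the same weight as Y, and Y - P would not have initial
    form Y. *)
Definition weight_ge (w : nat) G : Prop :=
  forall i j : nat, (2 * i + j < w)%N -> G`_j i = 0.

Lemma weight_geW v w G : (v <= w)%N -> weight_ge w G -> weight_ge v G.
Proof. by move=> le_vw wG i j lt_v; apply: wG; apply: leq_trans le_vw. Qed.

Lemma weight_ge0 G : weight_ge 0 G.
Proof. by []. Qed.

Lemma weight_geD w G H : weight_ge w G -> weight_ge w H -> weight_ge w (G + H).
Proof. by move=> wG wH i j lt_w; rewrite coefD /= wG ?wH ?addr0. Qed.

Lemma weight_geN w G : weight_ge w G -> weight_ge w (- G).
Proof. by move=> wG i j lt_w; rewrite coefN /= wG ?oppr0. Qed.

Lemma weight_geM v w G H :
  weight_ge v G -> weight_ge w H -> weight_ge (v + w) (G * H).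
Proof.
move=> wG wH i j lt_vw; rewrite coefps_coefM.
apply: big1 => k _; apply: big1 => l _.
have lt_k := ltn_ord k; have lt_l := ltn_ord l.
have [lt_v | le_v] := ltnP (2 * l + k) v; first by rewrite wG ?mul0r.
by rewrite wH ?mulr0 //; lia.
Qed.

Lemma weight_geX w G m : weight_ge w G -> weight_ge (w * m) (G ^+ m).
Proof.
move=> wG; elim: m => [|m IHm]; first by rewrite muln0.
by rewrite exprS mulnS; apply: weight_geM.
Qed.

Lemma weight_ge_polyX : weight_ge 1 'X.
Proof. by case=> [|i] [|j] // _; rewrite coefX. Qed.

Lemma weight_ge_polyC f : f 0%N = 0 -> weight_ge 2 f%:P.
Proof. by move=> f0 [|i] [|j] lt_ij; rewrite coefC //=; lia. Qed.

(** Multiplication by Y - f raises the weight by exactly 1, because f has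
    weight at least 2: if G has weight at least v then f G has weight at least
    v + 2, so that Y G has weight at least v + 2 whenever (Y - f) G does, and
    the weight of G is in fact at least v + 1. *)
Lemma weight_ge_cancel f w G : f 0%N = 0 ->
  weight_ge w.+1 (('X - f%:P) * G) -> weight_ge w G.
Proof.
move=> f0 wfG; suff wG v : (v <= w)%N -> weight_ge v G by exact: (wG w).
elim: v => [|v IHv] lt_vw; first exact: weight_ge0.
have wXG : weight_ge v.+2 ('X * G).
  have -> : 'X * G = ('X - f%:P) * G + f%:P * G by ring.
  apply: weight_geD; first exact: weight_geW wfG.
  by apply: (weight_geM (v := 2)); [exact: weight_ge_polyC | apply: IHv; lia].
move=> i j lt_v; have := wXG i j.+1; rewrite coefXM /=; apply; lia.
Qed.

(** * The ideal of negligible polynomials *)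

Definition negligible (M : nat) G : Prop :=
  forall i j : nat, (j < M)%N -> (2 * i + j < 2 * M)%N -> G`_j i = 0.

Lemma negligible_weight M G : weight_ge (2 * M) G -> negligible M G.
Proof. by move=> wG i j _; apply: wG. Qed.

Lemma negligible_polyXn M : negligible M 'X^M.
Proof. by move=> i j lt_jM _; rewrite coefXn ltn_eqF. Qed.

Lemma negligibleD M G H : negligible M G -> negligible M H ->
  negligible M (G + H).
Proof. by move=> nG nH i j ltj lti; rewrite coefD /= nG ?nH ?addr0. Qed.

Lemma negligibleMl M G H : negligible M H -> negligible M (G * H).
Proof.
move=> nH i j lt_jM lt_ij; rewrite coefps_coefM.
apply: big1 => k _; apply: big1 => l _.
by have lt_k := ltn_ord k; have lt_l := ltn_ord l; rewrite nH ?mulr0 //; lia.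
Qed.

(** A polynomial of weight at least 1 is nilpotent modulo the ideal, so that
    1 - V is invertible modulo the ideal. *)
Lemma negligible_cancel_unit M V G : weight_ge 1 V ->
  negligible M ((1 - V) * G) -> negligible M G.
Proof.
move=> wV nVG; set k := (2 * M)%N.
have -> : G = (\sum_(i < k) V ^+ i) * ((1 - V) * G) + V ^+ k * G.
  have := subrX1 V k; set T := \sum_(i < k) _ => eqT.
  have -> : V ^+ k = 1 + (V - 1) * T by rewrite -eqT; ring.
  ring.
apply: negligibleD; first exact: negligibleMl.
apply: negligible_weight; rewrite -[(2 * M)%N]addn0.
apply: weight_geM; last exact: weight_ge0.
by rewrite -[(2 * M)%N]mul1n; apply: weight_geX.
Qed.

End Weight.

(** * The truncated formula over power series in X *)

(** The powers of Y in a geometric sum align the diagonal coefficients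
    [Y^i] A B^i at the single exponent M, which is how a sum over m becomes one
    coefficient of one polynomial. *)
Lemma coef_geometric_sum (S : comNzRingType) (A B : {poly S}) (M : nat) :
  (A * \sum_(i < M.+1) 'X^(M - i) * B ^+ i)`_M =
    \sum_(i < M.+1) (A * B ^+ i)`_i.
Proof.
rewrite mulr_sumr coef_sum; apply: eq_bigr => i _.
have le_iM : (i <= M)%N by rewrite -ltnS.
by rewrite mulrCA coefXnM ltnNge leq_subr /= subKn.
Qed.

Section TruncatedFormula.
Variable R : comNzRingType.

(** The root f gives a factor of Y - p, and the cofactor has constant term 1
    since it differs from the derivative 1 - p' by a multiple of Y - f. *)
Lemma fixpoint_factor (p : {poly powser R}) (f : powser R) :
    f 0%N = 0 -> p`_1 0%N = 0 -> p.[f] = f ->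
  exists2 U, 'X - p = U * ('X - f%:P) & weight_ge 1 (1 - U).
Proof.
move=> f0 p10 pf.
have /factor_theorem[U eqU] : root ('X - p) f.
  by rewrite rootE hornerD hornerN hornerX pf subrr.
exists U => // -[|i] [|j] // _.
have := congr1 (fun G : {poly powser R} => G^`()`_0 0%N) eqU.
rewrite derivM !derivB derivX derivC subr0 mulr1 !coefD coefN coef_deriv.
rewrite mulr1n !coef1 /= p10 coefps_coefM !big_ord1 /=.
rewrite coefB coefX coefC /= f0 !subr0 mulr0 add0r => U00.
by rewrite coefN /= -U00 subrr.
Qed.

(** The formula [Y^-1] Y Q' / Q = f, with the quotient by Q replaced by a
    geometric sum truncated at M. The bound 2n <= M makes the weight of
    X^n Y^(M-1) smaller than 2M, so that this coefficient of a negligible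
    polynomial vanishes. *)
Lemma truncated_residue_formula (p : {poly powser R}) (f : powser R) (M n : nat)
    (Qd := 1 - p^`()) :
    f 0%N = 0 -> weight_ge 2 p -> p.[f] = f -> (1 < M)%N -> (2 * n <= M)%N ->
  (\sum_(i < M) (Qd * p ^+ i.+1)`_i) n = f n.
Proof.
case: M => // M f0 wp pf M_gt0 le_nM.
have [U eqU wU] := fixpoint_factor f0 (wp 0 1 isT) pf.
have eqQd : Qd = U^`() * ('X - f%:P) + U.
  have := congr1 (@deriv _) eqU.
  by rewrite derivM !derivB derivX derivC subr0 mulr1.
pose S : {poly powser R} := \sum_(i < M.+1) 'X^(M - i) * p ^+ i.
pose D : {poly powser R} := \sum_(i < M.+1) 'X^(M - i) * f%:P ^+ i.
have eqS : ('X - p) * S = 'X^(M.+1) - p ^+ M.+1 by rewrite subrXX.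
have eqD : ('X - f%:P) * D = 'X^(M.+1) - f%:P ^+ M.+1 by rewrite subrXX.
have wpM : weight_ge (2 * M.+1) (p ^+ M.+1) by apply: weight_geX.
have nQS : negligible M.+1 (('X - p) * S).
  rewrite eqS; apply: negligibleD; first exact: negligible_polyXn.
  exact/negligible_weight/weight_geN.
have nfS : negligible M.+1 (('X - f%:P) * S).
  apply: negligible_cancel_unit wU _.
  suff -> : (1 - (1 - U)) * (('X - f%:P) * S) = ('X - p) * S by [].
  by rewrite eqU; ring.
have wUSD : weight_ge (2 * M.+1).-1 (U * S - D).
  apply: (weight_ge_cancel f0); rewrite prednK //.
  have -> : ('X - f%:P) * (U * S - D) = f%:P ^+ M.+1 - p ^+ M.+1.
    have -> : ('X - f%:P) * (U * S - D) =
      U * ('X - f%:P) * S - ('X - f%:P) * D by ring.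
    by rewrite -eqU eqS eqD; ring.
  apply: weight_geD; last exact: weight_geN.
  by apply: weight_geX; apply: weight_ge_polyC.
have nYD : negligible M.+1 (Qd * p * S - 'X * D).
  have -> : Qd * p * S - 'X * D =
      - Qd * (('X - p) * S) + U^`() * 'X * (('X - f%:P) * S)
      + 'X * (U * S - D) by rewrite eqQd; ring.
  apply: negligibleD; last first.
    by apply: negligible_weight; apply: (weight_geM (v := 1) (@weight_ge_polyX _)).
  by apply: negligibleD; apply: negligibleMl.
have := nYD n M; rewrite coefB /= => /(_ (ltnSn _)) eq_n.
have {eq_n} /subr0_eq eq_n : (Qd * p * S)`_M n - ('X * D)`_M n = 0.
  by apply: eq_n; lia.
transitivity ((Qd * p * S)`_M n).
  rewrite coef_geometric_sum; congr (coefps _ n).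
  by apply: eq_bigr => i _; rewrite exprS mulrA.
rewrite eq_n coef_geometric_sum.
(* Only the term Y f^1 has a monomial with as many factors Y as factors f. *)
rewrite (bigD1 (Ordinal (M_gt0 : 1 < M.+1)%N)) //= big1 => [|i ne_i1].
  by rewrite addr0 expr1 coefMC coefX mul1r.
rewrite -polyC_exp coefMC coefX; case: eqP => [i1|_]; last by rewrite mul0r.
by case/eqP: ne_i1; apply: val_inj.
Qed.

End TruncatedFormula.

(** * The formula for polynomials *)

Lemma coefXY_map (R : comNzRingType) (A : {poly {poly R}}) (i j : nat) :
  coefXY i j A = (map_poly (@powser_of_poly R) A)`_j i.
Proof. by rewrite coef_map. Qed.

Theorem theorem5 (kappa : fieldType) (P : {poly {poly kappa}})
    (P00 : P.[0].[0] = 0) (dP00 : P^`().[0].[0] = 0)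
    (f : powser kappa) (f0 : f 0%N = 0) (fP : f = subst_powser P f)
    (n : nat) (n_ge1 : (1 <= n)%N) :
  finite_set [set m : nat | (1 <= m)%N /\
    coefXY n m.-1 ((1 - P^`()) * P ^+ m) != 0] /\
  f n = \sum_(m \in [set m : nat | (1 <= m)%N])
    coefXY n m.-1 ((1 - P^`()) * P ^+ m).
Proof.
pose p := map_poly (@powser_of_poly kappa) P.
have wp : weight_ge 2 p.
  move=> i j lt_ij; rewrite coef_map /=.
  have -> : i = 0%N by lia.
  have [-> | ->] : j = 0%N \/ j = 1%N by lia.
    by rewrite -!horner_coef0.
  by move: dP00; rewrite !horner_coef0 coef_deriv mulr1n.
have coefE m j : coefXY n j ((1 - P^`()) * P ^+ m) =
    ((1 - p^`()) * p ^+ m)`_j n.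
  by rewrite coefXY_map rmorphM rmorphB rmorph1 rmorphXn deriv_map.
have coef0 m : (2 * n < m)%N -> coefXY n m.-1 ((1 - P^`()) * P ^+ m) = 0.
  move=> lt_m; rewrite coefE.
  have wQP := weight_geM (@weight_ge0 _ (1 - p^`())) (weight_geX (m := m) wp).
  by apply: wQP; lia.
split.
  apply: (sub_finite_set (B := `I_(2 * n).+1)); last exact: finite_II.
  move=> m [_ /eqP nz_m] /=; rewrite ltnNge; apply/negP => lt_m.
  exact/nz_m/coef0.
have pf : p.[f] = f by rewrite [RHS]fP.
rewrite (fsbigE (index_iota 1 (2 * n).+1)) ?iota_uniq //; first last.
- by move=> m /= m_gt0; rewrite mem_index_iota m_gt0 ltnS -ltnNge; apply: coef0.
- by move=> m /=; rewrite mem_index_iota => /andP[].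
rewrite big_seq_cond (eq_bigl (fun m => m \in index_iota 1 (2 * n).+1)).
  rewrite -big_seq big_add1 big_mkord.
  rewrite -(truncated_residue_formula (M := 2 * n) f0 wp pf) //; last by lia.
  by rewrite coefps_sum; apply: eq_bigr => i _; rewrite coefE.
move=> m; rewrite mem_index_iota; case: (ltnP 0 m) => //= m_gt0.
by rewrite mem_set ?andbT.
Qed.
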